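(* Let $f:\mathbb{R}^{n\times p}\to\mathbb{R}$ satisfy the smoothness assumption of the context with constant $\rho$, let $\gamma>\rho$ (and $\gamma>0$), and let $\{X^{(k)}\}_{k\ge 0}\subset\mathcal{S}_{n,p}$ be any iterate sequence generated by the multipliers correction method with proximal parameter $\gamma$ and reduction constant $c_1>0$. Then $\{X^{(k)}\}$ has at least one convergent subsequence. Furthermore, each accumulation point $X^{\ast}$ of $\{X^{(k)}\}$ satisfies the first-order stationarity condition $$(I_n-X^{\ast}(X^{\ast})^{\top})\nabla f(X^{\ast})=0,\qquad (X^{\ast})^{\top}\nabla f(X^{\ast})=\nabla f(X^{\ast})^{\top}X^{\ast},\qquad (X^{\ast})^{\top}X^{\ast}=I_p.$$ More precisely, the inequality $$\min_{1\le k\le K}\left\|\nabla f(X^{(k)})-X^{(k)}\nabla f(X^{(k)})^{\top}X^{(k)}\right\|_{\mathrm F}\le\sqrt{\frac{c_2\left(f(X^{(0)})-\underline{f}\right)}{K}}$$ holds for any $K\ge 1$, where $\underline{f}=\min_{X\in\mathcal{S}_{n,p}}f(X)$ and $$c_2=\frac{1}{c_1}+\frac{8(\gamma+\rho)^2}{\gamma-\rho}>0.$$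
   Context: Let $1\le p\le n$ be integers and $\mathcal{S}_{n,p}=\{X\in\mathbb{R}^{n\times p}: X^{\top}X=I_p\}$ (the Stiefel manifold). $\|\cdot\|_{\mathrm F}$ is the Frobenius norm, and $\nabla f(X)\in\mathbb{R}^{n\times p}$ is the Euclidean gradient with respect to the inner product $\langle Y_1,Y_2\rangle=\mathrm{tr}(Y_1^{\top}Y_2)$. Smoothness assumption: $f:\mathbb{R}^{n\times p}\to\mathbb{R}$ is continuously differentiable and twice differentiable, and $\rho:=\sup_{X\in\tilde{\mathcal S}}\|\nabla^2 f(X)\|_2<\infty$, where $\tilde{\mathcal S}=\{Y\in\mathbb{R}^{n\times p}:\|Y\|_{\mathrm F}^2<p+1\}$ and $\|\nabla^2f(X)\|_2$ is the operator norm of the Hessian as a linear map on $(\mathbb{R}^{n\times p},\|\cdot\|_{\mathrm F})$. Multipliers correction method: fix $\gamma>0$ and $c_1>0$. Start from any $X^{(0)}\in\mathcal{S}_{n,p}$. For each $k=0,1,2,\dots$: (1) Function value reduction step: choose any $\bar X^{(k)}\in\mathcal{S}_{n,p}$ with $$f(X^{(k)})-f(\bar X^{(k)})\ge c_1\left\|\left(I_n-X^{(k)}(X^{(k)})^{\top}\right)\nabla f(X^{(k)})\right\|_{\mathrm F}^2 .$$ (2) Proximal correction step: let $Z^{(k)}=(\bar X^{(k)})^{\top}\nabla f(\bar X^{(k)})-\gamma I_p$. If $Z^{(k)}=0$, set $X^{(k+1)}=\bar X^{(k)}$. Otherwise take a singular value decomposition $Z^{(k)}=U\Sigma V^{\top}$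 ($U,V\in\mathbb{R}^{p\times p}$ orthogonal, $\Sigma$ diagonal with nonnegative entries), set $Q^{(k)}=-UV^{\top}$ and $X^{(k+1)}=\bar X^{(k)}Q^{(k)}$. The iterate sequence is understood as the infinite sequence obtained without applying a stopping test. *)

(* Defs.v *)
From HB Require Import structures.
From mathcomp Require Import all_boot all_order all_algebra.
From mathcomp Require Import all_classical all_reals all_analysis.

Set Implicit Arguments.
Unset Strict Implicit.
Unset Printing Implicit Defensive.
Import Order.TTheory GRing.Theory Num.Theory.
Import numFieldNormedType.Exports.
Local Open Scope classical_set_scope.
Local Open Scope ring_scope.

(* The topology (limits, continuity, differentials) on 'M[R]_(n, p) is the
   library's, induced by the entrywise max norm; it is the topology of the
   Frobenius norm. Every norm written below is [frob]. *)

Section Frobenius.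
Context {R : realType} {n p : nat}.
Implicit Types A B : 'M[R]_(n, p).

Definition mxdot A B : R := \tr (A^T *m B).

Definition frob A : R := Num.sqrt (mxdot A A).

End Frobenius.

Definition stiefel {R : realType} (n p : nat) : set 'M[R]_(n, p) :=
  [set X | X^T *m X = 1%:M].

Section Smoothness.
Context {R : realType} {n p : nat}.

(* See [gradE]: the representer of 'd f X for [mxdot]. *)
Definition grad (f : 'M[R]_(n, p) -> R^o) (X : 'M[R]_(n, p)) : 'M[R]_(n, p) :=
  \matrix_(i, j) 'd f X (delta_mx i j).

Lemma gradE (f : 'M[R]_(n, p) -> R^o) (X H : 'M[R]_(n, p)) :
  'd f X H = mxdot (grad f X) H.
Proof.
rewrite {1}(matrix_sum_delta H) linear_sum /mxdot /mxtrace.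
transitivity (\sum_i \sum_j H i j * 'd f X (delta_mx i j)).
  by apply: eq_bigr => i _; rewrite linear_sum; apply: eq_bigr => j _; rewrite linearZ.
rewrite exchange_big /=; apply: eq_bigr => j _.
by rewrite mxE; apply: eq_bigr => i _; rewrite !mxE mulrC.
Qed.

(* The Hessian at X is the linear map 'd (grad f) X. *)
Definition hess_opnorm (f : 'M[R]_(n, p) -> R^o) (X : 'M[R]_(n, p)) : \bar R :=
  ereal_sup [set (frob ('d (grad f) X H))%:E | H in [set H | frob H <= 1]].

Definition stiefel_nbhd : set 'M[R]_(n, p) :=
  [set Y | frob Y ^+ 2 < p%:R + 1].

Definition smooth_with (f : 'M[R]_(n, p) -> R^o) (rho : R) : Prop :=
  [/\ (forall X, differentiable f X) /\ continuous (grad f),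
      forall X, differentiable (grad f) X &
      ereal_sup [set hess_opnorm f X | X in stiefel_nbhd] = rho%:E].

End Smoothness.

Section Method.
Context {R : realType} {n p : nat}.
Implicit Types (f : 'M[R]_(n, p) -> R^o) (X Xbar : 'M[R]_(n, p)).

Definition is_svd (Z U V : 'M[R]_p) (s : 'rV[R]_p) : Prop :=
  [/\ U^T *m U = 1%:M, V^T *m V = 1%:M, forall i, 0 <= s 0 i &
      Z = U *m diag_mx s *m V^T].

Definition reduction_step f (c1 : R) X Xbar : Prop :=
  stiefel Xbar /\
  f X - f Xbar >= c1 * frob ((1%:M - X *m X^T) *m grad f X) ^+ 2.

Definition correction_step f (gamma : R) Xbar X' : Prop :=
  let Z := Xbar^T *m grad f Xbar - gamma%:M in
  if Z == 0 then X' = Xbar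
  else exists U V s, is_svd Z U V s /\ X' = Xbar *m (- (U *m V^T)).

Definition mcm_iterates f (gamma c1 : R) (X : nat -> 'M[R]_(n, p)) : Prop :=
  stiefel (X 0%N) /\
  forall k, exists Xbar,
    reduction_step f c1 (X k) Xbar /\ correction_step f gamma Xbar (X k.+1).

Definition is_min_on (A : set 'M[R]_(n, p)) f (m : R) : Prop :=
  [set f X | X in A] m /\ lbound [set f X | X in A] m.

End Method.

(* Main.v *)
Require Import Defs.
From HB Require Import structures.
From mathcomp Require Import all_boot all_order all_algebra.
From mathcomp Require Import all_classical all_reals all_analysis.
From mathcomp Require Import ring lra.

Set Implicit Arguments.
Unset Strict Implicit.
Unset Printing Implicit Defensive.
Import Order.TTheory GRing.Theory Num.Theory.
Import numFieldNormedType.Exports.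
Local Open Scope classical_set_scope.
Local Open Scope ring_scope.

(** The residual [grad f X - X *m (grad f X)^T *m X] is an orthogonal sum of the
    part of the gradient normal to the column space of [X] and of [X] times the
    skew part of [X^T *m grad f X] ([frob_residual_sqr]). Each half-step of the
    method pays for one of the two parts by a decrease of [f].

    The reduction step pays for the normal part by definition. The correction
    step pays for the skew part: with [Z = Xbar^T *m G - gamma%:M], where [G] is
    the gradient at [Xbar], the new point is [Xbar *m Q] with [Q] orthogonal,
    [Q^T *m Z] symmetric and [<Z, Q> <= \tr Z] ([svd_procrustes]). On one hand,
    since all points have orthonormal columns, this trace inequality and the
    second-order upper bound for [f] along a chord ([descent]) give a decrease
    of at least [(gamma - rho) / 2] times the squared length of the move
    ([correction_decrease]). On the other hand, by the symmetry of [Q^T *m Z],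
    the skew part at the new point comes only from [gamma *: (Q^T - Q)] and from
    the variation of the gradient between the two points, hence it is at most
    [2 (gamma + rho)] times the length of the move ([correction_skew]).

    So the squared residual at the [k+1]-st iterate is at most [c2] times the
    decrease of [f] between two consecutive intermediate points
    ([residual_sqr_le]). Summing this telescopes and gives the rate
    ([bigmin_telescope]); as [f] is bounded below on the Stiefel manifold, it
    also forces the residuals to tend to 0, so that by continuity they vanish
    at every accumulation point. Compactness of the Stiefel manifold
    ([stiefel_compact]) provides the minimum of [f] and a convergent
    subsequence. *)

(** * The Frobenius inner product *)

Section FrobeniusTheory.
Context {R : realType}.

Lemma mxdotE m q (A B : 'M[R]_(m, q)) :
  mxdot A B = \sum_i \sum_j A i j * B i j.
Proof.
rewrite /mxdot /mxtrace exchange_big /=; apply: eq_bigr => j _.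
by rewrite mxE; apply: eq_bigr => i _; rewrite mxE.
Qed.

Lemma mxdotC m q (A B : 'M[R]_(m, q)) : mxdot A B = mxdot B A.
Proof. by rewrite /mxdot -mxtrace_tr trmx_mul trmxK. Qed.

Lemma mxdotDr m q (A B C : 'M[R]_(m, q)) :
  mxdot A (B + C) = mxdot A B + mxdot A C.
Proof. by rewrite /mxdot mulmxDr mxtraceD. Qed.

Lemma mxdotDl m q (A B C : 'M[R]_(m, q)) :
  mxdot (A + B) C = mxdot A C + mxdot B C.
Proof. by rewrite mxdotC mxdotDr !(mxdotC C). Qed.

Lemma mxdotZr m q a (A B : 'M[R]_(m, q)) : mxdot A (a *: B) = a * mxdot A B.
Proof. by rewrite /mxdot -scalemxAr mxtraceZ. Qed.

Lemma mxdotZl m q a (A B : 'M[R]_(m, q)) : mxdot (a *: A) B = a * mxdot A B.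
Proof. by rewrite mxdotC mxdotZr mxdotC. Qed.

Lemma mxdotNr m q (A B : 'M[R]_(m, q)) : mxdot A (- B) = - mxdot A B.
Proof. by rewrite -scaleN1r mxdotZr mulN1r. Qed.

Lemma mxdotNl m q (A B : 'M[R]_(m, q)) : mxdot (- A) B = - mxdot A B.
Proof. by rewrite mxdotC mxdotNr mxdotC. Qed.

Lemma mxdot0r m q (A : 'M[R]_(m, q)) : mxdot A 0 = 0.
Proof. by rewrite /mxdot mulmx0 mxtrace0. Qed.

Lemma mxdot_mull m n q (A : 'M[R]_(m, n)) (B : 'M[R]_(n, q)) C :
  mxdot (A *m B) C = mxdot B (A^T *m C).
Proof. by rewrite /mxdot trmx_mul mulmxA. Qed.

Lemma mxdot_ge0 m q (A : 'M[R]_(m, q)) : 0 <= mxdot A A.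
Proof.
by rewrite mxdotE; apply: sumr_ge0 => i _; apply: sumr_ge0 => j _; exact: sqr_ge0.
Qed.

Lemma frob_ge0 m q (A : 'M[R]_(m, q)) : 0 <= frob A.
Proof. exact: sqrtr_ge0. Qed.

Lemma frob_sqr m q (A : 'M[R]_(m, q)) : frob A ^+ 2 = mxdot A A.
Proof. by rewrite sqr_sqrtr // mxdot_ge0. Qed.

Lemma entry_le_frob m q (A : 'M[R]_(m, q)) i j : `|A i j| <= frob A.
Proof.
rewrite -(@ler_pXn2r _ 2) ?nnegrE ?frob_ge0 //.
rewrite frob_sqr real_normK ?num_real // mxdotE (bigD1 i) //= (bigD1 j) //=.
rewrite -expr2 -addrA lerDl addr_ge0 //.
  by apply: sumr_ge0 => k _; exact: sqr_ge0.
by apply: sumr_ge0 => k _; apply: sumr_ge0 => l _; exact: sqr_ge0.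
Qed.

Lemma frob0_eq0 m q (A : 'M[R]_(m, q)) : frob A = 0 -> A = 0.
Proof.
move=> A0; apply/matrixP => i j; rewrite mxE; apply/normr0_eq0/le_anti.
by rewrite normr_ge0 andbT -A0 entry_le_frob.
Qed.

Lemma frob0 m q : frob (0 : 'M[R]_(m, q)) = 0.
Proof. by rewrite /frob mxdot0r sqrtr0. Qed.

Lemma frobZ m q a (A : 'M[R]_(m, q)) : frob (a *: A) = `|a| * frob A.
Proof.
by rewrite /frob mxdotZl mxdotZr mulrA -expr2 sqrtrM ?sqr_ge0 // sqrtr_sqr.
Qed.

Lemma frobN m q (A : 'M[R]_(m, q)) : frob (- A) = frob A.
Proof. by rewrite -scaleN1r frobZ normrN1 mul1r. Qed.

Lemma frob_tr m q (A : 'M[R]_(m, q)) : frob A^T = frob A.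
Proof. by rewrite /frob /mxdot trmxK mxtrace_mulC. Qed.

Lemma cauchy_schwarz m q (A B : 'M[R]_(m, q)) : mxdot A B <= frob A * frob B.
Proof.
have [a0|a0] := eqVneq (frob A) 0.
  by rewrite (frob0_eq0 a0) mxdotC mxdot0r frob0 mul0r.
have [b0|b0] := eqVneq (frob B) 0.
  by rewrite (frob0_eq0 b0) mxdot0r frob0 mulr0.
(* expand the square of the difference of A and B, scaled to equal norms *)
have := mxdot_ge0 (frob B *: A - frob A *: B).
rewrite mxdotDl !mxdotDr !mxdotNl !mxdotNr !mxdotZl !mxdotZr (mxdotC B A).
rewrite -!frob_sqr => ge0.
have abgt0 : 0 < frob A * frob B.
  by rewrite mulr_gt0 // lt_neqAle eq_sym frob_ge0 ?a0 ?b0.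
by rewrite -(ler_pM2l abgt0); lra.
Qed.

Lemma frobD m q (A B : 'M[R]_(m, q)) : frob (A + B) <= frob A + frob B.
Proof.
rewrite -(@ler_pXn2r _ 2) ?nnegrE ?addr_ge0 ?frob_ge0 // sqrrD !frob_sqr.
rewrite mxdotDl !mxdotDr (mxdotC B A).
by have := cauchy_schwarz A B; lra.
Qed.

Lemma frobD_orthogonal m q (A B : 'M[R]_(m, q)) :
  mxdot A B = 0 -> frob (A + B) ^+ 2 = frob A ^+ 2 + frob B ^+ 2.
Proof. by move=> AB; rewrite !frob_sqr mxdotDl !mxdotDr (mxdotC B) AB addr0 add0r. Qed.

(** * Matrices with orthonormal columns *)

Section Stiefel.
Variables (n p : nat) (X : 'M[R]_(n, p)).
Hypothesis XX : X^T *m X = 1%:M.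

Lemma frob_mul_stiefel q (A : 'M[R]_(p, q)) : frob (X *m A) = frob A.
Proof. by rewrite /frob mxdot_mull mulmxA XX mul1mx. Qed.

Lemma mul_tr_proj_stiefel : X^T *m (1%:M - X *m X^T) = 0.
Proof. by rewrite mulmxBr mulmx1 mulmxA XX mul1mx subrr. Qed.

(** [X *m X^T] is an orthogonal projector, so the two parts of [A] that it
    separates satisfy Pythagoras. *)
Lemma frob_trmul_stiefel_le q (A : 'M[R]_(n, q)) : frob (X^T *m A) <= frob A.
Proof.
rewrite -(@ler_pXn2r _ 2) ?nnegrE ?frob_ge0 //.
have AE : A = X *m (X^T *m A) + (1%:M - X *m X^T) *m A.
  by rewrite mulmxBl mul1mx mulmxA addrC subrK.
rewrite [in leRHS]AE frobD_orthogonal ?frob_mul_stiefel ?lerDl ?sqr_ge0 //.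
by rewrite mxdot_mull mulmxA mul_tr_proj_stiefel mul0mx mxdot0r.
Qed.

(** The residual splits into the component normal to the column space of [X],
    controlled by the reduction step, and the skew part of [X^T *m G],
    controlled by the correction step. *)
Lemma frob_residual_sqr (G : 'M[R]_(n, p)) :
  frob (G - X *m G^T *m X) ^+ 2 =
  frob ((1%:M - X *m X^T) *m G) ^+ 2 + frob (X^T *m G - G^T *m X) ^+ 2.
Proof.
rewrite -(frob_mul_stiefel (X^T *m G - _)) -frobD_orthogonal.
  by rewrite mulmxBr mulmxBl mul1mx !mulmxA addrA subrK.
by rewrite mxdotC mxdot_mull mulmxA mul_tr_proj_stiefel mul0mx mxdot0r.
Qed.

Lemma residual_eq0 (G : 'M[R]_(n, p)) : G - X *m G^T *m X = 0 ->
  (1%:M - X *m X^T) *m G = 0 /\ X^T *m G = G^T *m X.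
Proof.
move/(congr1 (@frob _ _ _)); rewrite frob0 => r0.
have := frob_residual_sqr G; rewrite r0 expr0n /= => /esym/eqP.
rewrite paddr_eq0 ?sqr_ge0 // !sqrf_eq0 => /andP[/eqP/frob0_eq0 ? /eqP/frob0_eq0].
by move/eqP; rewrite subr_eq0 => /eqP.
Qed.

Lemma stiefel_mul q (Q : 'M[R]_(p, q)) :
  Q^T *m Q = 1%:M -> (X *m Q)^T *m (X *m Q) = 1%:M.
Proof. by move=> QQ; rewrite trmx_mul -mulmxA (mulmxA X^T) XX mul1mx. Qed.

Lemma frob_stiefel : frob X ^+ 2 = p%:R.
Proof. by rewrite frob_sqr /mxdot XX mxtrace1. Qed.

(** This bound serves twice: for the boundedness of the Stiefel manifold, and
    for the trace inequality satisfied by the correction matrix. *)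
Lemma stiefel_entry_le1 i j : `|X i j| <= 1.
Proof.
have : (X^T *m X) j j = 1 by rewrite XX mxE eqxx.
rewrite mxE (bigD1 i) //= mxE => e.
rewrite -(@ler_pXn2r _ 2) ?nnegrE // expr1n real_normK ?num_real // -e -expr2 lerDl.
by apply: sumr_ge0 => k _; rewrite mxE; exact: sqr_ge0.
Qed.

End Stiefel.

(** * The correction matrix *)

(** The two consequences that matter when an orthogonal [Q] minimizes
    [mxdot Z Q] over the orthogonal group: the stationarity condition of that
    problem, and the comparison of [Q] with the identity. For [Z = 0] they hold
    with [Q = 1%:M], so that the step that keeps the point is covered. *)
Definition procrustes p (Z Q : 'M[R]_p) : Prop :=
  [/\ Q^T *m Q = 1%:M, Q^T *m Z = Z^T *m Q & mxdot Z Q <= \tr Z].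

(** For [Q = - (U *m V^T)], the product [Q^T *m Z] is [- V *m diag_mx s *m V^T],
    which is symmetric, of trace [- \sum_i s 0 i]. As [V^T *m U] is orthogonal,
    its diagonal entries are at least -1, so that [\tr Z], which is the trace of
    [diag_mx s *m (V^T *m U)], is at least as large. *)
Lemma svd_procrustes p (Z U V : 'M[R]_p) (s : 'rV[R]_p) :
  is_svd Z U V s -> procrustes Z (- (U *m V^T)).
Proof.
case=> UU VV s0 ZE.
have VV' : V *m V^T = 1%:M by rewrite mulmx1C.
have QZ : (U *m V^T)^T *m Z = V *m diag_mx s *m V^T.
  by rewrite ZE trmx_mul trmxK -!mulmxA (mulmxA U^T) UU mul1mx.
have QZtr : ((U *m V^T)^T *m Z)^T = (U *m V^T)^T *m Z.
  by rewrite QZ !trmx_mul trmxK tr_diag_mx mulmxA.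
split.
- rewrite [_^T]linearN /= mulNmx mulmxN opprK trmx_mul trmxK.
  by rewrite -mulmxA (mulmxA U^T) UU mul1mx.
- by rewrite [_^T]linearN /= mulNmx mulmxN -{1}QZtr trmx_mul trmxK.
- have WW : (V^T *m U)^T *m (V^T *m U) = 1%:M.
    by rewrite trmx_mul trmxK -mulmxA (mulmxA V) VV' mul1mx.
  rewrite mxdotNr mxdotC /mxdot QZ -mulmxA mxtrace_mulC -mulmxA VV mulmx1.
  rewrite ZE -mulmxA [\tr (U *m _)]mxtrace_mulC -mulmxA.
  rewrite mxtrace_diag -sumrN /mxtrace; apply: ler_sum => i _.
  rewrite mul_diag_mx [leRHS]mxE -mulrN1 ler_wpM2l //.
  by have := stiefel_entry_le1 WW i i; rewrite ler_norml => /andP[].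
Qed.

End FrobeniusTheory.

(** * Second-order bounds from the Hessian *)

Lemma is_derive_line (R : realType) (V W : normedModType R) (g : V -> W)
    (x v : V) (t : R) :
  differentiable g (x + t *: v) ->
  is_derive t 1 (fun s : R => g (x + s *: v)) ('d g (x + t *: v) v).
Proof.
move=> dg.
have dl : is_diff t (fun s : R => x + s *: v) (fun s : R => s *: v).
  by apply: is_diff_eq; rewrite add0r.
have dgl : differentiable (g \o (fun s : R => x + s *: v)) t.
  exact: differentiable_comp.
apply: DeriveDef; first exact: diff_derivable.
rewrite deriveE // diff_comp //=.
by rewrite diff_val scale1r.
Qed.

Lemma line_continuous (R : realType) (V W : normedModType R) (g : V -> W)
    (x v : V) (A : set R) : (forall y, differentiable g y) ->
  {within A, continuous (fun s : R => g (x + s *: v))}.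
Proof.
move=> dg; apply: continuous_subspaceT => t.
apply/differentiable_continuous; rewrite -derivable1_diffP.
by have [] := is_derive_line (dg (x + t *: v)).
Qed.

Section SecondOrder.
Context {R : realType} {n p : nat}.
Implicit Types X Y D H : 'M[R]_(n, p).

Lemma mxdot_continuous H : continuous (mxdot H).
Proof.
have -> : mxdot H = fun A => \sum_i \sum_j H i j * A i j.
  by apply/funext => A; rewrite mxdotE.
apply: continuous_big => [|i _]; first exact: add_continuous.
apply: continuous_big => [|j _]; first exact: add_continuous.
move=> A; apply: (@continuousM R _ (fun=> H i j)).
  exact: cst_continuous.
exact: coord_continuous.
Qed.

Lemma is_diff_mxdot (g : 'M[R]_(n, p) -> 'M[R]_(n, p)) H X :
  differentiable g X ->
  is_diff X (fun Y => mxdot H (g Y) : R^o) (fun D => mxdot H ('d g X D)).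
Proof.
move=> dg.
have lin : linear (mxdot H : _ -> R^o) by move=> a u v; rewrite mxdotDr mxdotZr.
pose L : {linear 'M[R]_(n, p) -> R^o} :=
  HB.pack (mxdot H : _ -> R^o) (GRing.isLinear.Build _ _ _ _ _ lin).
have cL : continuous L by exact: mxdot_continuous.
have dL : differentiable L (g X) by exact: linear_differentiable.
apply: DiffDef; first exact: (differentiable_comp dg dL).
by rewrite (diff_comp dg dL) diff_lin.
Qed.

Variables (f : 'M[R]_(n, p) -> R^o) (rho : R).
Hypothesis hf : smooth_with f rho.

Let df X : differentiable f X. Proof. by case: hf => [[]]. Qed.

Let dgrad X : differentiable (grad f) X. Proof. by case: hf. Qed.

Lemma hessian_bound X D : frob X ^+ 2 < p%:R + 1 ->
  frob ('d (grad f) X D) <= rho * frob D.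
Proof.
move=> hX; case: hf => _ _ hsup.
have le1 H : frob H <= 1 -> frob ('d (grad f) X H) <= rho.
  move=> H1; rewrite -lee_fin -hsup.
  apply: (@le_trans _ _ (hess_opnorm f X)); apply: ereal_sup_ubound.
    by exists H.
  by exists X.
have [/frob0_eq0->|D0] := eqVneq (frob D) 0.
  by rewrite linear0 !frob0 mulr0.
have Dgt0 : 0 < frob D by rewrite lt_neqAle eq_sym D0 frob_ge0.
have := le1 ((frob D)^-1 *: D).
rewrite frobZ ger0_norm ?invr_ge0 ?frob_ge0 // mulVf // lexx => /(_ isT).
rewrite linearZ frobZ ger0_norm ?invr_ge0 ?frob_ge0 //.
by rewrite mulrC ler_pdivrMr.
Qed.

(** The open ball on which the Hessian is bounded is convex and contains the
    Stiefel manifold, hence every chord between two of its points. *)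
Lemma stiefel_segment X Y t : stiefel X -> stiefel Y -> 0 <= t <= 1 ->
  frob (X + t *: (Y - X)) ^+ 2 < p%:R + 1.
Proof.
move=> hX hY /andP[t0 t1].
have fX : frob X ^+ 2 = p%:R := frob_stiefel hX.
have fY : frob Y ^+ 2 = p%:R := frob_stiefel hY.
have XY : mxdot X Y <= p%:R.
  have := mxdot_ge0 (X - Y).
  rewrite mxdotDl !mxdotDr !mxdotNl !mxdotNr (mxdotC Y X) -!frob_sqr fX fY; lra.
apply: (@le_lt_trans _ _ p%:R); last by rewrite ltrDl.
have -> : X + t *: (Y - X) = (1 - t) *: X + t *: Y.
  by rewrite scalerBr scalerBl scale1r addrCA addrC.
rewrite frob_sqr mxdotDl !mxdotDr !mxdotZl !mxdotZr (mxdotC Y X).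
rewrite -!frob_sqr fX fY.
have : 0 <= t * (1 - t) * (p%:R - mxdot X Y).
  by rewrite !mulr_ge0 ?subr_ge0.
by nra.
Qed.

(** The chord lies in the ball where the Hessian is bounded. The factor [s] is
    kept because the descent lemma uses the bound at every point of the chord. *)
Lemma grad_lipschitz X Y s : stiefel X -> stiefel Y -> 0 <= s <= 1 ->
  frob (grad f (X + s *: (Y - X)) - grad f X) <= rho * s * frob (Y - X).
Proof.
move=> hX hY /andP[s0 s1]; set D := Y - X.
set E := grad f (X + s *: D) - grad f X.
(* the mean value theorem for the component of the gradient along E *)
pose g Z : R^o := mxdot E (grad f Z).
have dg Z : is_diff Z g (fun D => mxdot E ('d (grad f) Z D)).
  exact: is_diff_mxdot.
have [|c|c] := @MVT_segment R (fun t : R => g (X + t *: D))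
    (fun t => mxdot E ('d (grad f) (X + t *: D) D)) 0 s s0.
- move=> t _.
  have := is_derive_line (@ex_diff _ _ _ _ _ _ _ (dg (X + t *: D))).
  by rewrite diff_val.
- by apply: line_continuous => Z; have [] := dg Z.
rewrite in_itv /= => /andP[c0 cs].
rewrite scale0r addr0 subr0 {1 2}/g -mxdotNr -mxdotDr -frob_sqr => e.
have hc : frob ('d (grad f) (X + c *: D) D) <= rho * frob D.
  apply: hessian_bound; apply: stiefel_segment => //.
  by rewrite c0 (le_trans cs).
have [->|E0] := eqVneq (frob E) 0.
  by rewrite mulrAC mulr_ge0 // (le_trans (frob_ge0 _) hc).
have Egt0 : 0 < frob E by rewrite lt_neqAle eq_sym E0 frob_ge0.
rewrite -(ler_pM2l Egt0) -expr2 e.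
rewrite [rho * s]mulrC -mulrA mulrCA mulrC ler_wpM2l //.
by rewrite (le_trans (cauchy_schwarz _ _)) // ler_wpM2l // frob_ge0.
Qed.

(** With [D = Y - X], the function
    [t |-> f (X + t D) - t <grad f X, D> - rho t^2 |D|^2 / 2] has a nonpositive
    derivative on [0, 1], because the gradient varies by at most [rho t |D|]
    along the chord. *)
Lemma descent X Y : stiefel X -> stiefel Y ->
  f Y <= f X + mxdot (grad f X) (Y - X) + rho / 2 * frob (Y - X) ^+ 2.
Proof.
have arith (a b c N u v : R) :
    v - (b + rho / 2 * N ^+ 2) - u = a - (b + c * (rho * N ^+ 2)) ->
    a - b <= rho * c * N * N -> v <= u + b + rho / 2 * N ^+ 2 by lra.
move=> hX hY; pose D : 'M[R]_(n, p) := Y - X.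
rewrite -/D.
pose g (t : R) : R := f (X + t *: D).
pose q (t : R) : R := t * mxdot (grad f X) D + t ^+ 2 * (rho / 2 * frob D ^+ 2).
pose dq (t : R) : R := mxdot (grad f X) D + t * (rho * frob D ^+ 2).
have Dq t : is_derive t (1:R) q (dq t).
  by apply: is_derive_eq; rewrite /dq /GRing.scale /=; field.
have [|c|c] := @MVT_segment R (g - q)
    (fun t => mxdot (grad f (X + t *: D)) D - dq t) 0 1 ler01.
- move=> t _; apply: is_deriveB.
  by rewrite -gradE; exact: is_derive_line.
- move=> x; apply: continuousB; first exact: line_continuous.
  apply: continuous_subspaceT => t; apply/differentiable_continuous.
  by rewrite -derivable1_diffP; have [] := Dq t.
rewrite in_itv /= => hc.
have -> : (g - q) 0 = f X by rewrite !fctE /g /q scale0r addr0 expr0n !mul0r addr0 subr0.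
have -> : (g - q) 1 = f Y - q 1.
  by rewrite !fctE /g scale1r /D [X + _]addrC subrK.
rewrite subr0 mulr1 /q expr1n !mul1r => e.
have lip : mxdot (grad f (X + c *: D)) D - mxdot (grad f X) D
    <= rho * c * frob D * frob D.
  rewrite -mxdotNl -mxdotDl (le_trans (cauchy_schwarz _ _)) //.
  by rewrite ler_wpM2r ?frob_ge0 //; exact: grad_lipschitz.
exact: arith e lip.
Qed.

End SecondOrder.

(** * Limits of matrices *)

Section MatrixLimits.
Context {R : realType}.

Lemma mx_cvg (T : Type) (F : set_system T) (FF : Filter F) m q
    (M : T -> 'M[R]_(m, q)) (l : 'M[R]_(m, q)) :
  (forall i j, M x i j @[x --> F] --> l i j) -> M @ F --> l.
Proof.
move=> cM A [P Pl sPA].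
apply: (@filterS _ F _ [set x | forall i j, P i j (M x i j)]).
  by move=> x Px; exact: sPA.
by apply: filter_forall => i; apply: filter_forall => j; apply: cM; exact: Pl.
Qed.

Lemma entry_cvg (T : Type) (F : set_system T) (FF : Filter F) m q
    (M : T -> 'M[R]_(m, q)) (l : 'M[R]_(m, q)) i j :
  M @ F --> l -> M x i j @[x --> F] --> l i j.
Proof. move=> cM; apply: (cvg_comp M (fun A : 'M[R]_(m, q) => A i j) cM).
exact: coord_continuous. Qed.

Lemma cvg_trmx (T : Type) (F : set_system T) (FF : Filter F) m q
    (M : T -> 'M[R]_(m, q)) (l : 'M[R]_(m, q)) :
  M @ F --> l -> (M x)^T @[x --> F] --> l^T.
Proof.
move=> cM; apply: mx_cvg => i j; rewrite mxE.
under eq_cvg do rewrite mxE.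
exact: entry_cvg.
Qed.

Lemma cvg_mulmx (T : Type) (F : set_system T) (FF : Filter F) m q r
    (M : T -> 'M[R]_(m, q)) (N : T -> 'M[R]_(q, r)) (l : 'M[R]_(m, q))
    (k : 'M[R]_(q, r)) :
  M @ F --> l -> N @ F --> k -> M x *m N x @[x --> F] --> l *m k.
Proof.
move=> cM cN; apply: mx_cvg => i j; rewrite mxE.
under eq_cvg do rewrite mxE.
apply: cvg_big => [|h _]; first exact: add_continuous.
by apply: cvgM; exact: entry_cvg.
Qed.

Lemma stiefel_closed n p : closed (@stiefel R n p).
Proof.
have -> : @stiefel R n p = (fun X => X^T *m X) @^-1` [set 1%:M] by [].
apply: preimage_closed.
  move=> X _; apply: (@cvg_mulmx _ (nbhs X) _ _ _ _ (@trmx R n p) id).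
    by apply: (@cvg_trmx _ (nbhs X) _ _ _ id); exact: cvg_id.
  exact: cvg_id.
exact/accessible_closed_set1/hausdorff_accessible/norm_hausdorff.
Qed.

(** Reading a matrix as a row vector reduces compactness to the Heine-Borel
    theorem for row vectors. *)
Lemma stiefel_compact n p : compact (@stiefel R n p).
Proof.
have cvec : continuous (@vec_mx R n p).
  move=> v; apply: (@mx_cvg _ (nbhs v)) => i j; rewrite mxE.
  under eq_cvg do rewrite mxE.
  exact: coord_continuous.
have -> : @stiefel R n p = vec_mx @` (vec_mx @^-1` (@stiefel R n p)).
  apply/seteqP; split=> [X hX|_ [v hv <-] //].
  by exists (mxvec X); rewrite /preimage /= mxvecK.
apply: continuous_compact; first exact: continuous_subspaceT.
apply: bounded_closed_compact; last first.
  by apply: preimage_closed; [move=> v _; exact: cvec|exact: stiefel_closed].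
exists 1; split=> // M M1 v hv /=.
rewrite (le_trans _ (ltW M1)) // [leLHS]/Num.Def.normr /= mx_normrE.
apply: bigmax_le => // -[i j] _ /=.
rewrite (ord1 i); case/mxvec_indexP: j => a b.
by rewrite -(vec_mxK v) mxvecE stiefel_entry_le1.
Qed.

Lemma stiefel_nonempty n p : (p <= n)%N -> @stiefel R n p !=set0.
Proof.
move=> pn; exists (pid_mx p).
by rewrite /stiefel /= tr_pid_mx mul_pid_mx !minnn (minn_idPr pn) pid_mx_1.
Qed.

Lemma cluster_subsequence (V : normedModType R) (u : nat -> V) (a : V) :
  cluster (u @ \oo) a ->
  exists2 phi : nat -> nat, {homo phi : i j / (i < j)%N} & u \o phi @ \oo --> a.
Proof.
(* reduction to the real sequence of the distances to [a] *)
move=> ua.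
have /cluster_eventually_cvg[phi phiinc] : cluster ((fun k => `|a - u k|) @ \oo) 0.
  apply/cluster_eventuallyP => e N e0.
  have uN : (u @ \oo) [set u k | k in [set k | (N <= k)%N]].
    by exists N => // k /= Nk; exists k.
  have [_ [[k Nk <-] ball_k]] := ua _ _ uN (nbhsx_ballx a e e0).
  exists k => //; rewrite sub0r normrN normr_id ltW //.
  by move: ball_k; rewrite -ball_normE.
move=> cvg0; exists phi.
  move=> i j.
  by rewrite (leqW_mono (phiinc : {mono phi : i j / (i <= j)%N})).
apply/cvgrPdist_le => e e0.
move/cvgrPdist_le : cvg0 => /(_ e e0); apply: filterS => k /=.
by rewrite sub0r normrN normr_id.
Qed.

End MatrixLimits.

(** * The correction step *)

Section Correction.
Context {R : realType} {n p : nat}.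
Variables (f : 'M[R]_(n, p) -> R^o) (rho gamma : R).
Hypothesis hf : smooth_with f rho.
Hypothesis gamma_gt0 : 0 < gamma.
Hypothesis rho_lt_gamma : rho < gamma.
Implicit Types X Xbar : 'M[R]_(n, p).

Lemma correction_procrustes Xbar X : correction_step f gamma Xbar X ->
  exists2 Q, procrustes (Xbar^T *m grad f Xbar - gamma%:M) Q & X = Xbar *m Q.
Proof.
rewrite /correction_step; case: ifPn => [/eqP Z0 ->|_ [U [V [s [svd ->]]]]].
  exists 1%:M; last by rewrite mulmx1.
  rewrite Z0; split; first by rewrite trmx1 mulmx1.
    by rewrite trmx0 mulmx0 mul0mx.
  by rewrite mxdotC mxdot0r mxtrace0.
by exists (- (U *m V^T)) => //; exact: svd_procrustes svd.
Qed.

Section Step.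
Variables (Xbar : 'M[R]_(n, p)) (Q : 'M[R]_p).
Hypothesis hXbar : stiefel Xbar.
Let G := grad f Xbar.
Hypothesis hQ : procrustes (Xbar^T *m G - gamma%:M) Q.
Let X := Xbar *m Q.

Let QQ : Q^T *m Q = 1%:M. Proof. by case: hQ. Qed.

Let hX : stiefel X. Proof. exact: stiefel_mul. Qed.

Let moveE : X - Xbar = Xbar *m (Q - 1%:M).
Proof. by rewrite mulmxBr mulmx1. Qed.

Let frob_move : frob (X - Xbar) = frob (Q - 1%:M).
Proof. by rewrite moveE frob_mul_stiefel. Qed.

(** The Stiefel constraint turns the linear term [gamma <1, Q - 1>] into
    [- gamma / 2] times the squared length of the move, so the proximal term
    beats the curvature [rho / 2] of [f]. *)
Lemma correction_decrease :
  (gamma - rho) / 2 * frob (X - Xbar) ^+ 2 <= f Xbar - f X.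
Proof.
have [_ _ trZ] := hQ.
have lin : mxdot G (X - Xbar) =
    mxdot (Xbar^T *m G - gamma%:M) (Q - 1%:M) - gamma / 2 * frob (X - Xbar) ^+ 2.
  have -> : mxdot G (X - Xbar) =
      mxdot (Xbar^T *m G - gamma%:M) (Q - 1%:M) + gamma * mxdot 1%:M (Q - 1%:M).
    rewrite -mxdotZl scalemx1 -mxdotDl subrK.
    by rewrite moveE mxdotC mxdot_mull mxdotC.
  have : frob (Q - 1%:M) ^+ 2 = - (2 * mxdot 1%:M (Q - 1%:M)).
    rewrite frob_sqr mxdotDl !mxdotDr !mxdotNl !mxdotNr (mxdotC Q 1%:M).
    have -> : mxdot Q Q = mxdot (1%:M : 'M[R]_p) 1%:M.
      by rewrite /mxdot QQ trmx1 mulmx1.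
    by ring.
  by rewrite -frob_move => ->; field.
have Z0 : mxdot (Xbar^T *m G - gamma%:M) (Q - 1%:M) <= 0.
  by rewrite mxdotDr mxdotNr subr_le0 [leRHS]mxdotC /mxdot trmx1 mul1mx.
have arith (u v a b N : R) : v <= u + a + rho / 2 * N ->
    a = b - gamma / 2 * N -> b <= 0 -> (gamma - rho) / 2 * N <= u - v by lra.
exact: arith (descent hf hXbar hX) lin Z0.
Qed.

(** [Q^T *m Z] is symmetric, so the skew part at the new point only sees
    [gamma *: (Q^T - Q)] and the variation of the gradient. *)
Lemma correction_skew :
  frob (X^T *m grad f X - (grad f X)^T *m X)
    <= 2 * (gamma + rho) * frob (X - Xbar).
Proof.
have [_ QZ _] := hQ.
pose E := grad f X - G.
have skewE : X^T *m grad f X - (grad f X)^T *m X =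
    gamma *: (Q^T - 1%:M) + - (gamma *: (Q - 1%:M))
    + (X^T *m E + - (X^T *m E)^T).
  have XG : X^T *m G = Q^T *m (Xbar^T *m G - gamma%:M) + gamma *: Q^T.
    by rewrite mulmxBr mul_mx_scalar subrK mulmxA /X trmx_mul.
  have XGt : (X^T *m G)^T = Q^T *m (Xbar^T *m G - gamma%:M) + gamma *: Q.
    by rewrite XG linearD /= trmx_mul trmxK -QZ linearZ /= trmxK.
  have -> : grad f X = G + E by rewrite /E addrC subrK.
  have -> : (G + E)^T *m X = (X^T *m (G + E))^T by rewrite trmx_mul trmxK.
  rewrite mulmxDr [(_ + _)^T]linearD /= XGt XG !scalerBr.
  by apply/matrixP => i j; rewrite !mxE; ring.
have Ele : frob E <= rho * frob (X - Xbar).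
  have := grad_lipschitz hf hXbar hX (s := 1).
  rewrite ler01 lexx => /(_ isT); rewrite mulr1 scale1r.
  by rewrite [X in grad f X - _](_ : _ = X) // addrC subrK.
have XEle : frob (X^T *m E) <= rho * frob (X - Xbar).
  exact: le_trans (frob_trmul_stiefel_le hX E) Ele.
have g0 := ltW gamma_gt0.
rewrite skewE (le_trans (frobD _ _)) //.
have := frobD (gamma *: (Q^T - 1%:M)) (- (gamma *: (Q - 1%:M))).
have := frobD (X^T *m E) (- (X^T *m E)^T).
rewrite !frobN !frobZ frob_tr (ger0_norm g0) -frob_move.
have -> : frob (Q^T - 1%:M) = frob (X - Xbar).
  by rewrite frob_move -frob_tr linearB /= trmxK trmx1.
move: XEle; lra.
Qed.

(** The square of the length of the move is eliminated between the two previous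
    bounds. *)
Lemma correction_skew_sqr :
  frob (X^T *m grad f X - (grad f X)^T *m X) ^+ 2
    <= 8 * (gamma + rho) ^+ 2 / (gamma - rho) * (f Xbar - f X).
Proof.
have gr : 0 < gamma - rho by rewrite subr_gt0.
have bound_ge0 := le_trans (frob_ge0 _) correction_skew.
apply: (@le_trans _ _ ((2 * (gamma + rho) * frob (X - Xbar)) ^+ 2)).
  by rewrite ler_pXn2r ?nnegrE ?frob_ge0 // correction_skew.
have -> : (2 * (gamma + rho) * frob (X - Xbar)) ^+ 2 =
    8 * (gamma + rho) ^+ 2 / (gamma - rho) *
    ((gamma - rho) / 2 * frob (X - Xbar) ^+ 2).
  by field; rewrite gt_eqF.
rewrite ler_wpM2l ?correction_decrease //.
by rewrite divr_ge0 ?(ltW gr) // mulr_ge0 ?sqr_ge0.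
Qed.

End Step.
End Correction.

(** * Convergence of the method *)

(** The square of the minimum is at most the average of the squares
    [r k ^+ 2], and the sum of these is bounded by a telescoping sum. *)
Lemma bigmin_telescope (R : realType) (r a : nat -> R) (c m : R) (K : nat) :
  (forall k, 0 <= r k) -> 0 <= c -> (forall k, m <= a k) ->
  (forall k, r k.+1 ^+ 2 <= c * (a k - a k.+1)) -> (1 <= K)%N ->
  \big[Order.min/r 1%N]_(1 <= k < K.+1) r k <= Num.sqrt (c * (a 0%N - m) / K%:R).
Proof.
move=> r0 c0 ma ra K1; set b := \big[_/_]_(_ <= _ < _) _.
have b0 : 0 <= b by exact: le_bigmin.
have K0 : 0 < K%:R :> R by rewrite ltr0n.
rewrite -[b]ger0_norm // -sqrtr_sqr ler_wsqrtr // ler_pdivlMr //.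
apply: (@le_trans _ _ (\sum_(0 <= k < K) r k.+1 ^+ 2)).
  rewrite mulr_natr -[X in _ *+ X]subn0 -sumr_const_nat big_nat [leRHS]big_nat.
  apply: ler_sum => k /andP[_ kK].
  rewrite ler_pXn2r ?nnegrE //; apply: ge_bigmin_seq => //.
  by rewrite mem_index_iota ltnS.
apply: (@le_trans _ _ (\sum_(0 <= k < K) c * (a k - a k.+1))).
  exact: ler_sum.
rewrite -mulr_sumr ler_wpM2l // -[leLHS]opprK -sumrN.
under eq_bigr do rewrite opprB.
by rewrite telescope_sumr // opprB lerB.
Qed.

Lemma decrements_cvg0 (R : realType) (a : nat -> R) (m : R) :
  (forall k, a k.+1 <= a k) -> (forall k, m <= a k) ->
  a k - a k.+1 @[k --> \oo] --> 0.
Proof.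
move=> dec ma.
have /cvg_ex[l al] : cvgn a.
  apply: nonincreasing_is_cvgn; first exact/nonincreasing_seqP.
  by exists m => _ [k _ <-].
rewrite -(subrr l); apply: cvgB => //.
by rewrite (@cvg_shiftS _ a).
Qed.

Section Convergence.
Context {R : realType} {n p : nat}.
Variables (f : 'M[R]_(n, p) -> R^o) (rho gamma c1 : R).
Hypothesis hf : smooth_with f rho.
Hypothesis gamma_gt0 : 0 < gamma.
Hypothesis rho_lt_gamma : rho < gamma.
Hypothesis c1_gt0 : 0 < c1.

Lemma smooth_continuous : continuous f.
Proof. by move=> X; apply: differentiable_continuous; case: hf => [[]]. Qed.

Lemma residual_cvg (X : nat -> 'M[R]_(n, p)) (Xs : 'M[R]_(n, p)) :
  X @ \oo --> Xs ->
  grad f (X k) - X k *m (grad f (X k))^T *m X k @[k --> \oo] -->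
  grad f Xs - Xs *m (grad f Xs)^T *m Xs.
Proof.
move=> cX.
have cG : grad f (X k) @[k --> \oo] --> grad f Xs.
  by apply: (cvg_comp X (grad f) cX); case: hf => [[_ cg] _ _]; exact: cg.
apply: cvgB => //; apply: cvg_mulmx => //; apply: cvg_mulmx => //.
exact: cvg_trmx.
Qed.

Let c2 := c1^-1 + 8 * (gamma + rho) ^+ 2 / (gamma - rho).

Let c3_ge0 : 0 <= 8 * (gamma + rho) ^+ 2 / (gamma - rho).
Proof.
have gr : 0 < gamma - rho by rewrite subr_gt0.
by rewrite divr_ge0 ?(ltW gr) // mulr_ge0 ?sqr_ge0.
Qed.

Lemma c2_gt0 : 0 < c2.
Proof. by rewrite ltr_wpDr // invr_gt0. Qed.

(** One correction step followed by one reduction step: the former pays for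
    the skew part of the residual at [X], the latter for its normal part. *)
Lemma residual_sqr_le Xbar X Xbar' : stiefel Xbar ->
  correction_step f gamma Xbar X -> reduction_step f c1 X Xbar' ->
  stiefel X /\
  frob (grad f X - X *m (grad f X)^T *m X) ^+ 2 <= c2 * (f Xbar - f Xbar').
Proof.
move=> hXbar /correction_procrustes[Q hQ XE] [_ red].
have [QQ _ _] := hQ.
have hX : stiefel X by rewrite XE; exact: stiefel_mul.
split=> //; rewrite (frob_residual_sqr hX).
have skew := correction_skew_sqr hf gamma_gt0 rho_lt_gamma hXbar hQ.
have dec := correction_decrease hf hXbar hQ.
rewrite -XE in skew dec.
have d2 : 0 <= f Xbar - f X.
  apply: le_trans dec; rewrite mulr_ge0 ?sqr_ge0 //.
  by rewrite divr_ge0 // subr_ge0 ltW.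
move: red; rewrite mulrC -ler_pdivlMr // mulrC => red.
have d1 : 0 <= f X - f Xbar'.
  by rewrite -(pmulr_rge0 _ (x := c1^-1)) ?invr_gt0 // (le_trans _ red) ?sqr_ge0.
have -> : f Xbar - f Xbar' = (f X - f Xbar') + (f Xbar - f X).
  by rewrite [RHS]addrC addrA subrK.
rewrite mulrDr lerD //.
  by apply: (le_trans red); rewrite ler_wpM2r // lerDl.
by apply: (le_trans skew); rewrite ler_wpM2r // lerDr invr_ge0 ltW.
Qed.

End Convergence.

Theorem theorem3p5 (R : realType) (n p : nat) (hp : (1 <= p)%N) (hpn : (p <= n)%N)
  (f : 'M[R]_(n, p) -> R^o) (rho gamma c1 : R)
  (hf : smooth_with f rho)
  (hgamma : rho < gamma) (hgamma0 : 0 < gamma) (hc1 : 0 < c1)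
  (X : nat -> 'M[R]_(n, p)) (hX : mcm_iterates f gamma c1 X) :
  [/\ exists phi : nat -> nat,
        {homo phi : i j / (i < j)%N} /\ cvg ((X \o phi) @ \oo),
      forall Xs : 'M[R]_(n, p), cluster (X @ \oo) Xs ->
        [/\ (1%:M - Xs *m Xs^T) *m grad f Xs = 0,
            Xs^T *m grad f Xs = (grad f Xs)^T *m Xs &
            Xs^T *m Xs = 1%:M] &
      let c2 := c1^-1 + 8 * (gamma + rho) ^+ 2 / (gamma - rho) in
      let r k := frob (grad f (X k) - X k *m (grad f (X k))^T *m X k) in
      0 < c2 /\
      exists fmin : R, is_min_on (@stiefel R n p) f fmin /\
        forall K : nat, (1 <= K)%N ->
          \big[Order.min/r 1%N]_(1 <= k < K.+1) r k
            <= Num.sqrt (c2 * (f (X 0%N) - fmin) / K%:R)].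
Proof.
set c2 := c1^-1 + _; have c2gt0 : 0 < c2 := c2_gt0 hgamma hc1.
have [X0 /choice[Xbar hstep]] := hX.
have hXbar k : stiefel (Xbar k) by have [[]] := hstep k.
have step k : stiefel (X k.+1) /\
    frob (grad f (X k.+1) - X k.+1 *m (grad f (X k.+1))^T *m X k.+1) ^+ 2
    <= c2 * (f (Xbar k) - f (Xbar k.+1)).
  have [_ cor] := hstep k; have [red _] := hstep k.+1.
  exact: residual_sqr_le cor red.
have hXk k : stiefel (X k) by case: k => [//|k]; have [] := step k.
have [Xm /set_mem hXm minXm] := compact_EVT_min (stiefel_nonempty hpn)
  (@stiefel_compact R n p) (continuous_subspaceT (smooth_continuous hf)).
have fmin Y : stiefel Y -> f Xm <= f Y by move=> hY; apply: minXm; exact/mem_set.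
have dec k : f (Xbar k.+1) <= f (Xbar k).
  have [_ le] := step k; rewrite -subr_ge0 -(pmulr_rge0 _ c2gt0).
  exact: le_trans (sqr_ge0 _) le.
pose r k := frob (grad f (X k) - X k *m (grad f (X k))^T *m X k).
have r0 : r k @[k --> \oo] --> 0.
  rewrite -cvg_shiftS /=.
  have d0 := decrements_cvg0 dec (fun k => fmin _ (hXbar k)).
  have s0 : Num.sqrt (c2 * (f (Xbar k) - f (Xbar k.+1))) @[k --> \oo] --> 0.
    rewrite -[X in _ --> X](sqrtr0 R) -[X in Num.sqrt X](mulr0 c2).
    have d0' : c2 * (f (Xbar k) - f (Xbar k.+1)) @[k --> \oo] --> c2 * 0.
      by apply: cvgM => //; exact: cvg_cst.
    by apply: (cvg_comp _ Num.sqrt d0'); exact: sqrt_continuous.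
  apply: squeeze_cvgr (@cvg_cst _ _ _ _ _) s0.
  apply: nearW => k /=; rewrite frob_ge0 /=.
  rewrite -[leLHS]ger0_norm ?frob_ge0 // -sqrtr_sqr ler_wsqrtr //.
  by have [] := step k.
split.
- have [|Xs [_ Xs_cl]] := @stiefel_compact R n p (X @ \oo) _.
    by exists 0%N => // k _ /=; exact: hXk.
  have [phi phi_inc cvgphi] := cluster_subsequence Xs_cl.
  by exists phi; split=> //; apply/cvg_ex; exists Xs.
- move=> Xs /cluster_subsequence[phi phi_inc cXs].
  have hXs : stiefel Xs.
    apply: (closed_cvg _ (@stiefel_closed R n p) _ _ cXs).
    by apply: nearW => k; exact: hXk.
  have phi_ge k : (k <= phi k)%N.
    by elim: k => // k IH; exact: leq_ltn_trans IH (phi_inc _ _ (ltnSn k)).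
  have phioo : phi @ \oo --> \oo.
    move=> A [N _ NA]; exists N => // k /= Nk; apply: NA => /=.
    exact: leq_trans Nk (phi_ge k).
  (* the limit of the residuals along the subsequence is both 0 and the
     residual at the accumulation point *)
  suff /(residual_eq0 hXs)[] : grad f Xs - Xs *m (grad f Xs)^T *m Xs = 0 by [].
  apply: (@cvg_unique _ (@norm_hausdorff _ _) _ _ _ _ (residual_cvg hf cXs)).
  apply: mx_cvg => i j; rewrite [X in _ --> X]mxE.
  apply/norm_cvg0P.
  apply: squeeze_cvgr (@cvg_cst _ _ _ _ _) (cvg_comp phi r phioo r0).
  by apply: nearW => k /=; rewrite normr_ge0 entry_le_frob.
- split=> //; exists (f Xm); split.
    by split; [exists Xm|move=> _ [Y hY <-]; exact: fmin].
  move=> K K1.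
  (* the telescoping sum starts from the value of [f] at the first
     intermediate point, which is at most its value at the initial point *)
  apply: le_trans
    (@bigmin_telescope _ _ (fun k => f (Xbar k)) c2 (f Xm) K _ _ _ _ K1) _.
  + by move=> k; exact: frob_ge0.
  + exact: ltW.
  + by move=> k; exact: fmin.
  + by move=> k; have [] := step k.
  rewrite ler_wsqrtr // ler_wpM2r ?invr_ge0 // ler_wpM2l ?(ltW c2gt0) // lerB //.
  have [[_ red] _] := hstep 0%N; rewrite -subr_ge0; apply: le_trans red.
  by rewrite mulr_ge0 ?(ltW hc1) ?sqr_ge0.
Qed.
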